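(* Let $|q|<1$ and define integers $k_n,\ell_n$ by $$\sum_{n=0}^{\infty}k_nq^n=(q,q^4;q^5)_\infty(q,q^9;q^{10})_\infty^3,\qquad \sum_{n=0}^{\infty}\ell_nq^n=(q^2,q^3;q^5)_\infty(q^3,q^7;q^{10})_\infty^3.$$ Then $k_{5n+4}=0$ and $\ell_{5n+4}=0$ for all $n\ge0$.
   Context: For complex $a$ and $|q|<1$, $(a;q)_\infty=\prod_{k=0}^{\infty}(1-aq^k)$ and $(a_1,\dots,a_m;q)_\infty=(a_1;q)_\infty\cdots(a_m;q)_\infty$. *)

(* Defs.v *)
From mathcomp Require Export all_boot all_order all_algebra.
From mathcomp Require Export all_classical all_reals all_analysis.
From mathcomp Require Export complex.
Export Order.TTheory GRing.Theory Num.Theory.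
Export numFieldNormedType.Exports.

Set Implicit Arguments.
Unset Strict Implicit.
Unset Printing Implicit Defensive.

#[global] Open Scope classical_set_scope.
#[global] Open Scope ring_scope.
#[global] Open Scope complex_scope.

(* The type cast to R[i]^o is what makes the library find the topology of R[i]
   given by the complex modulus.  The limit exists whenever `|q| < 1. *)
Definition qpoch (R : realType) (a q : R[i]) : R[i] :=
  lim ((\prod_(0 <= k < n) (1 - a * q ^+ k) : R[i]^o) @[n --> \oo]).

Definition qpochs (R : realType) (s : seq R[i]) (q : R[i]) : R[i] :=
  \prod_(a <- s) qpoch a q.

(* Main.v *)
Require Import Defs.
From mathcomp Require Import zify ring lra.

(** By the Jacobi triple product, up to a factor that is a power series in
    [q ^+ 5], each product is the signed theta series
    [\sum_(a, b, c, d) (-1) ^+ (a + b + c + d) * q ^+ Q(a, b, c, d)] with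
    [Q = (s a + 5 a (a - 1) / 2) + \sum_(x in {b, c, d}) (s x + 5 x ^ 2)], where
    [s = 4] for [k] and [s = 2] for [l].  If [Q] is 4 modulo 5, then
    [w := (2 (a + b + c + d) + s - 1) / 5] is an odd integer, and the reflection
    [(a, b, c, d) |-> (a - 2 w, b - w, c - w, d - w)] is an involution that
    preserves [Q] and reverses the sign, so all these terms cancel.

    To stay with polynomials, the triple product is used in its finite form,
    with weights the Gaussian binomials [2N, N + i], which agree with [2N, N]
    modulo [q ^+ (N - i)].  The coefficients of the given power series are those of
    the partial products, because for small real [t > 0] the infinite and the
    partial products differ by [O(t ^+ N)]. *)

Set Implicit Arguments.
Unset Strict Implicit.
Unset Printing Implicit Defensive.

(** * Gaussian binomials and their values near the middle index *)

Fixpoint qbinom {R : comNzRingType} (q : R) (n k : nat) : R :=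
  match n, k with
  | _, 0 => 1
  | 0, _.+1 => 0
  | n'.+1, k'.+1 => qbinom q n' k' + q ^+ k * qbinom q n' k
  end.

Lemma qbinom0 (R : comNzRingType) (q : R) n : qbinom q n 0 = 1.
Proof. by case: n. Qed.

Lemma qbinomS (R : comNzRingType) (q : R) n k :
  qbinom q n.+1 k.+1 = qbinom q n k + q ^+ k.+1 * qbinom q n k.+1.
Proof. by []. Qed.

Lemma qbinom_small (R : comNzRingType) (q : R) n k :
  (n < k)%N -> qbinom q n k = 0.
Proof.
elim: n k => [|n IHn] [|k] //= ltnk.
by rewrite !IHn ?mulr0 ?addr0 // ltnW.
Qed.

Lemma qbinom_ratio (R : comNzRingType) (q : R) n k : (k <= n)%N ->
  qbinom q n k.+1 * (1 - q ^+ k.+1) = qbinom q n k * (1 - q ^+ (n - k)).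
Proof.
elim: n k => [|n IHn] k.
  by rewrite leqn0 => /eqP->; rewrite subnn expr0 subrr mulr0 mul0r.
(* Absorption identity: the q-Pascal rule combined with the induction hypothesis. *)
have keyS j : (j <= n)%N ->
    qbinom q n.+1 j.+1 * (1 - q ^+ j.+1) = qbinom q n j * (1 - q ^+ n.+1).
  move=> lejn; rewrite qbinomS mulrDl -mulrA IHn //.
  have -> : q ^+ n.+1 = q ^+ j.+1 * q ^+ (n - j) by rewrite -exprD; congr (_ ^+ _); lia.
  by ring.
case: k => [_|k lekn].
  by rewrite keyS // !qbinom0 subn0.
have [lekn'|] := ltnP k n; last first.
  move=> lenk; have -> : k = n by lia.
  by rewrite subnn expr0 subrr mulr0 qbinom_small ?mul0r.
rewrite keyS // qbinomS subSS mulrDl.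
have := IHn k (ltnW lekn').
have -> : q ^+ n.+1 = q ^+ k.+1 * q ^+ (n - k) by rewrite -exprD; congr (_ ^+ _); lia.
by move=> E; rewrite -E; ring.
Qed.

(** Induction peels off the factor [k = 0], which replaces [y] by [y * q]. The form homogeneous in
    [u] and [y] keeps the exponents natural when [u] is a power of ['X]. *)
Lemma qbinomial_thm (R : comNzRingType) (q u y : R) n :
  \prod_(k < n) (u + y * q ^+ k) =
  \sum_(j < n.+1) q ^+ 'C(j, 2) * qbinom q n j * y ^+ j * u ^+ (n - j).
Proof.
elim: n y => [|n IHn] y.
  by rewrite big_ord0 big_ord1 /= !expr0 !mulr1.
rewrite big_ord_recl expr0 mulr1.
under eq_bigr => i _ do rewrite /= /bump /= add1n exprS mulrA.
rewrite IHn mulrDl !mulr_sumr.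
rewrite big_ord_recl /= [RHS]big_ord_recl /= -!addrA; congr (_ + _).
  by rewrite !qbinom0 !subn0 exprS; ring.
rewrite [RHS](eq_bigr (fun i : 'I_n.+1 =>
   u * (q ^+ 'C(i.+1, 2) * qbinom q n i.+1 * (y * q) ^+ i.+1 * u ^+ (n - i.+1))
 + y * (q ^+ 'C(i, 2) * qbinom q n i * (y * q) ^+ i * u ^+ (n - i)))); last first.
  move=> [i lti] _; rewrite /= /bump /= add1n subSS.
  rewrite binS bin1 !exprMn !exprD !exprS.
  have [lein|lein] := ltnP i n.
    have -> : u ^+ (n - i) = u * u ^+ (n - i.+1) by rewrite -exprS; congr (_ ^+ _); lia.
    by ring.
  by rewrite (@qbinom_small _ _ n i.+1) //; ring.
rewrite big_split /= [X in _ = X + _]big_ord_recr /= (@qbinom_small _ _ n n.+1) //.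
rewrite mulr0 !mul0r mulr0 addr0; congr (_ + _).
Qed.

Lemma qbinom_rmorph (R S : comNzRingType) (f : {rmorphism R -> S}) (q : R) n k :
  qbinom (f q) n k = f (qbinom q n k).
Proof.
elim: n k => [|n IHn] [|k] /=; rewrite ?rmorph1 ?rmorph0 //.
by rewrite !IHn -rmorphXn -rmorphM -rmorphD.
Qed.

(** In [qbinom_ratio] both factors [1 - q ^+ _] are 1 modulo [q ^+ (N - i.+1)], so each step away
    from the middle costs one power of [q]. *)
Lemma qbinom_mid_up (R : comNzRingType) (q : R) N i : (i <= N)%N ->
  exists r, qbinom q N.*2 (N + i) = qbinom q N.*2 N + q ^+ (N - i) * r.
Proof.
elim: i => [|i IHi] leiN; first by exists 0; rewrite addn0 mulr0 addr0.
have [r Er] := IHi (ltnW leiN).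
have := @qbinom_ratio _ q N.*2 (N + i) ltac:(lia); rewrite -addnS.
have -> : (N.*2 - (N + i) = (N - i.+1).+1)%N by lia.
have -> : q ^+ (N + i.+1) = q ^+ (N - i.+1) * q ^+ (i.+1).*2.
  by rewrite -exprD; congr (_ ^+ _); lia.
have Ei : q ^+ (N - i) = q ^+ (N - i.+1) * q by rewrite -exprSr; congr (_ ^+ _); lia.
move: Er; rewrite Ei exprSr => Er E.
set a := qbinom q _ (N + i.+1) in E *; set p := q ^+ (N - i.+1) in E Er *.
exists (q * r - qbinom q N.*2 (N + i) * q + a * q ^+ (i.+1).*2).
transitivity (a * (1 - p * q ^+ (i.+1).*2) + a * p * q ^+ (i.+1).*2); first by ring.
have -> : qbinom q N.*2 N = qbinom q N.*2 (N + i) - p * q * r by rewrite Er; ring.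
by rewrite E; ring.
Qed.

Lemma qbinom_mid_down (R : comNzRingType) (q : R) N i : (i <= N)%N ->
  exists r, qbinom q N.*2 (N - i) = qbinom q N.*2 N + q ^+ (N - i) * r.
Proof.
elim: i => [|i IHi] leiN; first by exists 0; rewrite subn0 mulr0 addr0.
have [r Er] := IHi (ltnW leiN).
have := @qbinom_ratio _ q N.*2 (N - i.+1) ltac:(lia).
have Ei : (N - i = (N - i.+1).+1)%N by lia.
rewrite -Ei.
have -> : q ^+ (N.*2 - (N - i.+1)) = q ^+ (N - i.+1) * q ^+ (i.+1).*2.
  by rewrite -exprD; congr (_ ^+ _); lia.
have Ep : q ^+ (N - i) = q ^+ (N - i.+1) * q by rewrite -exprSr Ei.
move: Er; rewrite Ep => Er E.
set a := qbinom q _ (N - i.+1) in E *; set p := q ^+ (N - i.+1) in E Er *.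
exists (q * r - qbinom q N.*2 (N - i) * q + a * q ^+ (i.+1).*2).
transitivity (a * (1 - p * q ^+ (i.+1).*2) + a * p * q ^+ (i.+1).*2); first by ring.
have -> : qbinom q N.*2 N = qbinom q N.*2 (N - i) - p * q * r by rewrite Er; ring.
by rewrite -E; ring.
Qed.

(** * The finite form of the triple product *)

Definition tri (i : int) : nat :=
  match i with Posz n => 'C(n, 2) | Negz n => 'C(n.+2, 2) end.

Lemma bin2_double n : (2 * 'C(n, 2) = n * n.-1)%N.
Proof. by rewrite mul2n bin2 halfK; case: n => //= n; rewrite oddM /= andNb subn0. Qed.

Lemma triE (i : int) : 2 * (tri i)%:Z = i * (i - 1).
Proof. by case: i => [[|n]|n] /=; have := bin2_double; [move/(_ 0%N)|move/(_ n.+1)|move/(_ n.+2)] => /=; nia. Qed.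

(** For [0 < s < b] the integer is nonnegative, so [absz] is only a cast. *)
Definition theta_exp (b s : nat) (i : int) : nat :=
  absz (s%:Z * i + b%:Z * (tri i)%:Z).

Lemma theta_expE b s i : (0 < s < b)%N ->
  (theta_exp b s i)%:Z = s%:Z * i + b%:Z * (tri i)%:Z.
Proof.
move=> /andP[s0 sb]; rewrite /theta_exp; have := triE i; set t := tri i => Et.
have : (0 <= i) || (i < 0) by lia.
case/orP => i0; first by nia.
have : (t%:Z >= - i) by nia.
nia.
Qed.

(** This growth offsets the loss of precision of the Gaussian weights away from the middle. *)
Lemma theta_exp_ge b s i : (0 < s < b)%N -> (absz i <= theta_exp b s i)%N.
Proof.
move=> sb; have := theta_expE i sb; have := triE i; set t := tri i => Et.
set e := theta_exp _ _ _.
case/andP: sb => s0 sb.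
have : (0 <= i) || (i < 0) by lia.
case/orP => i0; first by nia.
have : (t%:Z >= - i) by nia.
nia.
Qed.

Definition theta_prod (b s N : nat) : {poly int} :=
  \prod_(k < N) (1 - 'X^(s + b * k)) * \prod_(k < N) (1 - 'X^(b - s + b * k)).

(** The q-binomial theorem with base ['X^b], [2N] factors, [u = 'X^(b * N)] and [y = - 'X^s], after
    cancelling a signed monomial. *)
Lemma finite_triple_product b s N : (0 < s < b)%N ->
  theta_prod b s N =
  \sum_(j < N.*2.+1) (-1) ^+ (j + N) * 'X^(theta_exp b s (j%:Z - N%:Z)) *
     qbinom 'X^b N.*2 j.
Proof.
move=> sb; have /andP[s0 ltsb] := sb.
(* [D] gathers what leaves the factors ['X^(b * N) - 'X^(s + b * k)]: ['X^(b * N)] for [k >= N], and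
   [- 'X^(s + b * k)] for [k < N]. *)
set D : {poly int} := (-1) ^+ N * 'X^(b * (N * N) + s * N + b * 'C(N, 2)).
have D0 : D != 0.
  by rewrite mulf_neq0 // ?signr_eq0 // expf_neq0 // polyX_eq0.
apply: (mulfI D0); rewrite mulr_sumr.
transitivity (\prod_(k < N + N) (('X^(b * N) : {poly int}) + (- 'X^s) * ('X^b) ^+ k)).
  rewrite big_split_ord /= mulrC.
  rewrite [X in _ = _ * X](eq_bigr (fun k : 'I_N =>
     'X^(b * N) * (1 - 'X^(s + b * k)))); last first.
    move=> k _; rewrite -exprM mulrBr mulr1 mulNr -!exprD; congr (_ - 'X^_); lia.
  rewrite [X in _ = X * _](reindex_inj rev_ord_inj) /=.
  rewrite [X in _ = X * _](eq_bigr (fun k : 'I_N =>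
     (-1) * ('X^(s + b * (N - k.+1)) * (1 - 'X^(b - s + b * k))))); last first.
    move=> k _; rewrite -exprM mulN1r mulrBr mulr1 mulNr opprB -!exprD.
    congr (_ - _); congr ('X^_).
    have -> : (b * N = b * (N - k.+1) + b * k.+1)%N.
      by rewrite -mulnDr; congr (_ * _)%N; have := ltn_ord k; lia.
    rewrite mulnS; lia.
  rewrite !big_split /= !prodr_const !card_ord.
  have -> : \prod_(k < N) 'X^(s + b * (N - k.+1)) = 'X^(s * N + b * 'C(N, 2)) :> {poly int}.
    rewrite (reindex_inj rev_ord_inj) /=.
    rewrite (eq_bigr (fun k : 'I_N => 'X^(s + b * k))); last first.
      by move=> k _; congr ('X^(s + b * _)); have := ltn_ord k; lia.
    rewrite -expr_sum; congr ('X^_); rewrite big_split /= sum_nat_const card_ord mulnC.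
    by rewrite -big_distrr /= -bin2_sum big_mkord.
  rewrite /D /theta_prod -exprM -addnA exprD mulnA; ring.
rewrite addnn qbinomial_thm; apply: eq_bigr => -[j /= ltj] _.
have lejN : (j <= N.*2)%N by rewrite -ltnS.
have Ee : (b * 'C(j, 2) + s * j + b * N * (N.*2 - j) =
    b * (N * N) + s * N + b * 'C(N, 2) + theta_exp b s (j%:Z - N%:Z))%N.
  have := theta_expE (j%:Z - N%:Z) sb; have := triE (j%:Z - N%:Z).
  have := triE j; have := triE N; rewrite /=.
  set c := tri _; set e := theta_exp _ _ _; move: 'C(j, 2) 'C(N, 2) => cj cN.
  move=> EN Ej Ec Ee; apply/eqP; rewrite -eqz_nat; apply/eqP.
  rewrite !PoszD !PoszM -subzn // Ee -mul2n PoszM.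
  apply: (mulfI (_ : 2 != 0 :> int)) => //.
  have -> (x y z : int) : 2 * (b%:Z * x + y + z) = b%:Z * (2 * x) + 2 * (y + z) by ring.
  have -> (x y z w : int) : 2 * (x + y + b%:Z * z + (w + b%:Z * c%:Z)) =
     2 * (x + y + w) + b%:Z * (2 * z) + b%:Z * (2 * c%:Z) by ring.
  by rewrite EN Ej Ec; ring.
have -> : (- 'X^s : {poly int}) ^+ j = (-1) ^+ N * (-1) ^+ (j + N) * 'X^(s * j).
  rewrite [LHS]exprNn -exprM; congr (_ * _); rewrite -exprD addnCA addnn.
  by rewrite -[RHS]signr_odd oddD odd_double addbF signr_odd.
rewrite -!exprM.
transitivity ((-1) ^+ N * (-1) ^+ (j + N) * qbinom 'X^b N.*2 j *
   'X^(b * 'C(j, 2) + s * j + b * N * (N.*2 - j)) : {poly int}).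
  by rewrite !exprD; ring.
rewrite Ee /D (exprD _ _ (theta_exp b s _)); ring.
Qed.

(** * Congruence modulo a power of ['X], and truncated theta series *)

Definition eq_modX (N : nat) (p q : {poly int}) := exists r, p = q + 'X^N * r.

Lemma eq_modX_coef N p q i : eq_modX N p q -> (i < N)%N -> p`_i = q`_i.
Proof. by move=> [r ->] ltiN; rewrite coefD coefXnM ltiN addr0. Qed.

Lemma eq_modX_mul N p q p' q' :
  eq_modX N p q -> eq_modX N p' q' -> eq_modX N (p * p') (q * q').
Proof.
move=> [r ->] [r' ->]; exists (q * r' + q' * r + 'X^N * r * r'); ring.
Qed.

Lemma eq_modX_exp N p q n : eq_modX N p q -> eq_modX N (p ^+ n) (q ^+ n).
Proof.
move=> E; elim: n => [|n IHn]; first by exists 0; rewrite mulr0 addr0.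
by rewrite !exprS; apply: eq_modX_mul.
Qed.

Lemma eq_modX_sum N n (p q : 'I_n -> {poly int}) :
  (forall i, eq_modX N (p i) (q i)) -> eq_modX N (\sum_i p i) (\sum_i q i).
Proof.
move=> /choice[r Er]; exists (\sum_i r i).
by rewrite mulr_sumr -big_split /=; apply: eq_bigr.
Qed.

(** The theta series cut off at [|i| <= N], with [j = i + N]; the sign is that of [(-1)^i]. *)
Definition theta_sum (b s N : nat) : {poly int} :=
  \sum_(j < N.*2.+1) (-1) ^+ (j + N) * 'X^(theta_exp b s (j%:Z - N%:Z)).

(** The term of index [i] has exponent at least [|i|], and its weight is the central one modulo
    ['X^(b * (N - |i|))], so the error has order at least [N]. *)
Lemma theta_prod_modX b s N : (0 < s < b)%N ->
  eq_modX N (theta_prod b s N) (qbinom 'X^b N.*2 N * theta_sum b s N).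
Proof.
move=> sb; rewrite finite_triple_product // /theta_sum mulr_sumr.
apply: eq_modX_sum => -[j /= ltj].
set e := theta_exp _ _ _; have := theta_exp_ge (j%:Z - N%:Z) sb; rewrite -/e => lee.
have [i [leiN Ei [r ->]]] : exists i, [/\ (i <= N)%N, (i <= e)%N &
    exists r, qbinom ('X^b : {poly int}) N.*2 j =
              qbinom 'X^b N.*2 N + ('X^b) ^+ (N - i) * r].
  have [leNj|ltjN] := leqP N j.
    exists (j - N)%N; split; [lia|lia|].
    have {1}-> : j = (N + (j - N))%N by lia.
    by apply: qbinom_mid_up; lia.
  exists (N - j)%N; split; [lia|lia|].
  have {1}-> : j = (N - (N - j))%N by lia.
  by apply: qbinom_mid_down; lia.
exists ((-1) ^+ (j + N) * 'X^(e + b * (N - i) - N) * r).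
have -> : (('X^b : {poly int}) ^+ (N - i)) = 'X^(b * (N - i)) by rewrite exprM.
set q := qbinom _ _ _.
transitivity (q * ((-1) ^+ (j + N) * 'X^e) +
   (-1) ^+ (j + N) * 'X^(e + b * (N - i)) * r); first by rewrite (exprD _ e); ring.
have {1}-> : (e + b * (N - i) = N + (e + b * (N - i) - N))%N by nia.
by rewrite (exprD _ N); ring.
Qed.

(** * The sign-reversing reflection *)

Lemma sum_involution_eq0 (T : finType) (P : pred T) (F : T -> int) (h : T -> T) :
  {in P, forall x, P (h x)} -> {in P, forall x, h (h x) = x} ->
  {in P, forall x, F (h x) = - F x} -> \sum_(x | P x) F x = 0.
Proof.
move=> hP hK hF; suff E : \sum_(x | P x) F x = - \sum_(x | P x) F x by lia.
rewrite {1}(reindex_onto h h hK) /= -sumrN; apply: eq_big => [x|x].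
  apply/andP/idP => [[Phx /eqP <-]|Px]; first exact: hP.
  by split; [exact: hP|rewrite hK].
by move=> /andP[Phx /eqP Ex]; rewrite -{2}Ex [in RHS]hF ?opprK.
Qed.

Lemma mulr_sum_pair (R : comNzRingType) (I J : finType) (F : I -> R) (G : J -> R) :
  (\sum_i F i) * (\sum_j G j) = \sum_(p : I * J) F p.1 * G p.2.
Proof. by rewrite big_distrlr /= pair_bigA. Qed.

(** Subtracting [w] times [(2, 1, 1, 1)] changes the exponent by
    [5 w (5 w - 2 (a + b + c + d) - s + 1)], which is 0 here. *)
Lemma theta_exp_reflection s a b c d w :
  (0 < s < 5)%N -> 5 * w = 2 * (a + b + c + d) + s%:Z - 1 ->
  (theta_exp 5 s (a - 2 * w) + theta_exp 10 (s + 5) (b - w) +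
   (theta_exp 10 (s + 5) (c - w) + theta_exp 10 (s + 5) (d - w)) =
   theta_exp 5 s a + theta_exp 10 (s + 5) b +
   (theta_exp 10 (s + 5) c + theta_exp 10 (s + 5) d))%N.
Proof.
move=> s5 Ew; have s10 : (0 < s + 5 < 10)%N by lia.
apply/eqP; rewrite -eqz_nat !PoszD !theta_expE // PoszD; apply/eqP.
have Es : s%:Z = 5 * w - 2 * (a + b + c + d) + 1 by rewrite Ew; ring.
apply: (mulfI (_ : 2 != 0 :> int)) => //.
have L (x y z t x' y' z' t' u v : int) : 2 * (u * x + 5 * x' + (v * y + 10 * y')
    + (v * z + 10 * z' + (v * t + 10 * t'))) = 2 * (u * x + v * (y + z + t))
    + 5 * (2 * x') + 10 * (2 * y') + 10 * (2 * z') + 10 * (2 * t') by ring.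
by rewrite !L !triE Es; ring.
Qed.

Lemma theta_sum_coef_eq0 (s N m : nat) : s = 2%N \/ s = 4%N -> (5 * m + 4 < N)%N ->
  (theta_sum 5 s N * theta_sum 10 (s + 5) N *
   (theta_sum 10 (s + 5) N * theta_sum 10 (s + 5) N))`_(5 * m + 4) = 0.
Proof.
move=> s24 ltN.
have s5 : (0 < s < 5)%N by lia.
have s10 : (0 < s + 5 < 10)%N by lia.
pose I := 'I_N.*2.+1; pose T := ((I * I) * (I * I))%type.
pose ctr (i : I) : int := i%:Z - N%:Z.
pose tot (x : T) := ctr x.1.1 + ctr x.1.2 + ctr x.2.1 + ctr x.2.2.
pose E (x : T) := (theta_exp 5 s (ctr x.1.1) + theta_exp 10 (s + 5) (ctr x.1.2) +
  (theta_exp 10 (s + 5) (ctr x.2.1) + theta_exp 10 (s + 5) (ctr x.2.2)))%N.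
pose S (x : T) := (x.1.1 + x.1.2 + x.2.1 + x.2.2)%N.
rewrite /theta_sum !mulr_sum_pair coef_sum.
rewrite (eq_bigr (fun x : T => if E x == (5 * m + 4)%N then (-1) ^+ S x else 0 : int)).
  rewrite -big_mkcond /=.
  pose w (x : T) : int := ((2 * tot x + s%:Z - 1) %/ 5)%Z.
  pose back (i : int) : I := inord (absz (i + N%:Z)).
  have backK i : (absz i <= N)%N -> ctr (back i) = i.
    by move=> leiN; rewrite /ctr /back inordK; lia.
  have ctrK i : back (ctr i) = i.
    by apply: val_inj; rewrite /back /ctr /= inordK; have := ltn_ord i; lia.
  pose h (x : T) : T := ((back (ctr x.1.1 - 2 * w x), back (ctr x.1.2 - w x)),
                         (back (ctr x.2.1 - w x), back (ctr x.2.2 - w x))).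
  (* Modulo 5 the exponent is [s * tot x]. When it is 4, [2 * tot x + s - 1] is divisible by 5 for
     [s = 2] and [s = 4], so the division in [w] is exact. *)
  have wE x : E x == (5 * m + 4)%N -> 5 * w x = 2 * tot x + s%:Z - 1.
    have := erefl (tot x); rewrite /w {2}/tot; move: (tot x) => t Et /eqP.
    move=> /(congr1 Posz); rewrite !PoszD !theta_expE // PoszD => EE.
    by case: s24 => ?; subst s; lia.
  (* The reflected exponent is still [5 * m + 4 < N] and bounds the new coordinates, so they stay in
     the range where [back] is faithful. *)
  have hE x : E x == (5 * m + 4)%N ->
     [/\ ctr (h x).1.1 = ctr x.1.1 - 2 * w x, ctr (h x).1.2 = ctr x.1.2 - w x,
         ctr (h x).2.1 = ctr x.2.1 - w x & ctr (h x).2.2 = ctr x.2.2 - w x].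
    move=> Ex; have := etrans (theta_exp_reflection s5 (wE x Ex)) (eqP Ex).
    have := theta_exp_ge (ctr x.1.1 - 2 * w x) s5.
    have := theta_exp_ge (ctr x.1.2 - w x) s10.
    have := theta_exp_ge (ctr x.2.1 - w x) s10.
    have := theta_exp_ge (ctr x.2.2 - w x) s10.
    rewrite /h /=; move: (ctr x.1.1 - 2 * w x) (ctr x.1.2 - w x).
    move: (ctr x.2.1 - w x) (ctr x.2.2 - w x) => i j k l ? ? ? ? ?.
    by split; apply: backK; lia.
  have hP x : E x == (5 * m + 4)%N -> E (h x) == (5 * m + 4)%N.
    move=> Ex; have [E1 E2 E3 E4] := hE x Ex.
    rewrite -(eqP Ex) {1}/E E1 E2 E3 E4; apply/eqP.
    exact: theta_exp_reflection (wE x Ex).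
  apply: (@sum_involution_eq0 T _ _ h) => x Px.
  - exact: hP.
  - have [E1 E2 E3 E4] := hE x Px.
    (* The reflection lowers [tot] by [5 * w x]. *)
    have wh : w (h x) = - w x.
      have := wE _ Px; have := wE _ (hP _ Px); rewrite /tot E1 E2 E3 E4; lia.
    rewrite {1}/h E1 E2 E3 E4 wh mulrN !opprK !subrK !ctrK.
    by case: x {Px E1 E2 E3 E4 wh} => [[? ?] [? ?]].
  - have [E1 E2 E3 E4] := hE x Px; have := wE _ Px => Ew.
    (* [tot] changes by [5 * w x], and [w x] is odd because [s] is even. *)
    suff oddS : odd (S (h x)) = ~~ odd (S x).
      by rewrite -[LHS]signr_odd -[in RHS]signr_odd oddS; case: (odd _); rewrite ?opprK.
    move: Ew E1 E2 E3 E4; rewrite /tot /S /ctr; case: s24 => ?; subst s; lia.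
move=> x _; rewrite /= -/(ctr x.1.1) -/(ctr x.1.2) -/(ctr x.2.1) -/(ctr x.2.2).
rewrite [X in (polyseq X)`_ _](_ : _ = (-1) ^+ S x * 'X^(E x)).
  rewrite -signr_odd -[in RHS]signr_odd eq_sym.
  case: (odd _); last by rewrite expr0 mul1r coefXn; case: eqP.
  by rewrite expr1 mulN1r coefN coefXn; case: eqP; rewrite ?oppr0.
rewrite /S /E !(exprD 'X) 3!(exprD _ _ N) (exprD _ (x.2.2 : nat) N) !exprD.
have v2 : ((-1) ^+ N : {poly int}) ^+ 2 = 1 by rewrite sqrr_sign.
set v := (-1) ^+ N in v2 *.
transitivity ((-1) ^+ x.1.1 * (-1) ^+ x.1.2 * (-1) ^+ x.2.1 * (-1) ^+ x.2.2 *
  ('X^(theta_exp 5 s (ctr x.1.1)) * 'X^(theta_exp 10 (s + 5) (ctr x.1.2)) *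
  ('X^(theta_exp 10 (s + 5) (ctr x.2.1)) * 'X^(theta_exp 10 (s + 5) (ctr x.2.2))))
  * (v ^+ 2 * v ^+ 2) : {poly int}); first by ring.
by rewrite v2 !mulr1.
Qed.

(** * Removal of the central Gaussian binomials *)

(** Only exponents divisible by [b] occur in [g \Po 'X^b], so the convolution meets only
    coefficients of [p] in the class of [r]. *)
Lemma coef_comp_Xn_mul (b r : nat) (g p : {poly int}) (n : nat) :
  (0 < b)%N -> (forall m, (m <= n)%N -> p`_(b * m + r) = 0) -> (r < b)%N ->
  ((g \Po 'X^b) * p)`_(b * n + r) = 0.
Proof.
move=> b0 p0 rb; rewrite coefM big1 // => -[i /= lti] _.
rewrite coef_comp_poly_Xn //; case: ifP => [/dvdnP[j Ej]|]; last by rewrite mul0r.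
have lejn : (j <= n)%N by nia.
have -> : (b * n + r - i = b * (n - j) + r)%N by rewrite mulnBr; nia.
by rewrite p0 ?mulr0 // leq_subr.
Qed.

Lemma theta_prod_coef_eq0 (s N n : nat) : s = 2%N \/ s = 4%N -> (5 * n + 4 < N)%N ->
  (theta_prod 5 s N * theta_prod 10 (s + 5) N ^+ 3)`_(5 * n + 4) = 0.
Proof.
move=> s24 ltN.
have s5 : (0 < s < 5)%N by lia.
have s10 : (0 < s + 5 < 10)%N by lia.
have := eq_modX_mul (theta_prod_modX N s5) (eq_modX_exp 3 (theta_prod_modX N s10)).
move=> /eq_modX_coef -> //.
set p := theta_sum 5 s N; set q := theta_sum 10 (s + 5) N.
(* The central binomials have bases ['X^5] and ['X^10], so both are polynomials in ['X^5]. *)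
pose g : {poly int} := qbinom 'X N.*2 N * qbinom 'X^2 N.*2 N ^+ 3.
rewrite [X in (polyseq X)`_ _](_ : _ = (g \Po 'X^5) * (p * q * (q * q))).
  apply: coef_comp_Xn_mul => // m lemn; apply: theta_sum_coef_eq0 => //; lia.
have Xb (c : nat) : qbinom ('X^(5 * c) : {poly int}) N.*2 N = qbinom 'X^c N.*2 N \Po 'X^5.
  have -> : 'X^(5 * c) = 'X^c \Po 'X^5 :> {poly int} by rewrite comp_Xn_poly exprM.
  exact: (qbinom_rmorph (comp_poly ('X^5 : {poly int}))).
by rewrite (Xb 1%N) (Xb 2%N) /g rmorphM rmorphXn /= expr1; ring.
Qed.

(** * Recovering coefficients from values at small real arguments *)

Lemma norm_real_complex (R : rcfType) (x : R) : `|x%:C| = `|x|%:C.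
Proof. by rewrite normc_def /= expr0n /= addr0 sqrtr_sqr. Qed.

Lemma cvg_real_complex (R : realType) (u : nat -> R) (l : R) :
  ((u n)%:C : R[i]^o) @[n --> \oo] --> (l%:C : R[i]^o) <-> u n @[n --> \oo] --> l.
Proof.
split => /cvgrPdist_lt ul; apply/cvgrPdist_lt => e e0.
  have := ul e%:C; rewrite ltcR => /(_ e0); apply: filterS => n.
  by rewrite -rmorphB norm_real_complex ltcR.
move: e0; rewrite ltcE /= => /andP[/eqP Ime Ree].
have := ul _ Ree; apply: filterS => n ltn.
by rewrite -rmorphB norm_real_complex ltcE /= Ime eqxx.
Qed.

(** By strong induction the coefficients below [i] vanish, so the sum is [e i * t ^+ i] up to
    [O(t ^+ i.+1)]; hence [|e i| <= K * t] for all small [t]. *)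
Lemma power_series_coef_eq0 (R : realType) (e : nat -> R) (N : nat) (C : R) :
  (forall t : R, 0 < t <= 2^-1 ->
     exists2 L : R, series (fun n => e n * t ^+ n) @ \oo --> L & `|L| <= C * t ^+ N) ->
  forall i, (i < N)%N -> e i = 0.
Proof.
move=> H; have half_norm : `|2^-1| = 2^-1 :> R by rewrite ger0_norm.
have [B B0 eB] : exists2 B, 0 <= B & forall n, `|e n| * 2^-1 ^+ n <= B.
  have [|L cL _] := H 2^-1; first by lra.
  have : cvgn (series (fun n => e n * 2^-1 ^+ n)) by apply/cvg_ex; exists L.
  move=> /cvg_series_bounded /ex_strict_bound_gt0[B B0 HB].
  exists B => [|n]; first exact: ltW.
  by have := HB n I; rewrite /= normrM normrX half_norm => /ltW.
move=> i; have [n] := ubnP i; elim: n i => // n IHn i ltin ltiN.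
(* [|C|] comes from the bound on [L], the rest from the tail bound [2 * B * (2 * t) ^+ i.+1] divided
   by [t ^+ i.+1]. *)
pose K := `|C| + B * 2 ^+ i.+2.
have K0 : 0 <= K by rewrite addr_ge0 // mulr_ge0 // exprn_ge0.
have key t : 0 < t <= 4^-1 -> `|e i| <= K * t.
  move=> /andP[t0 t4]; have t0' := ltW t0.
  have [|L cL LC] := H t; first by rewrite t0; lra.
  have x0 : 0 <= 2 * t by rewrite mulr_ge0.
  (* As [2 * t <= 1/2], the geometric tail is at most twice its first term; the subtracted
     [2 * (2 * t) ^+ m] closes the induction. *)
  have tail m : (i < m)%N -> `|series (fun n => e n * t ^+ n) m - e i * t ^+ i| <=
      B * (2 * (2 * t) ^+ i.+1 - 2 * (2 * t) ^+ m).
    elim: m => // m IHm; rewrite ltnS leq_eqVlt => /orP[/eqP <-|ltim].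
      rewrite subrr mulr0 seriesEnat /= big_nat_recr //= big_nat big1 ?add0r ?subrr ?normr0 //.
      by move=> j ltji; rewrite IHn ?mul0r //; lia.
    rewrite -[X in series _ X]addn1 addn1 seriesSr addrAC.
    apply: le_trans (ler_normD _ _) _.
    apply: le_trans (lerD (IHm ltim) (lexx _)) _.
    have em : `|e m * t ^+ m| <= B * (2 * t) ^+ m.
      have -> : e m * t ^+ m = e m * 2^-1 ^+ m * (2 * t) ^+ m.
        by rewrite -mulrA -exprMn mulKf.
      by rewrite normrM [X in _ * X]ger0_norm ?exprn_ge0 // ler_wpM2r ?exprn_ge0 // normrM normrX half_norm.
    apply: le_trans (lerD (lexx _) em) _.
    rewrite -mulrDr ler_wpM2l // (exprS _ m).
    have xm : 0 <= (2 * t) ^+ m by rewrite exprn_ge0.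
    have : 0 <= (1 - 4 * t) * (2 * t) ^+ m by rewrite mulr_ge0 //; lra.
    by move: (_ ^+ i.+1) (_ ^+ m) => y x; nra.
  have Li : `|L - e i * t ^+ i| <= B * (2 * (2 * t) ^+ i.+1).
    have cL' : (fun m => `|series (fun n => e n * t ^+ n) m - e i * t ^+ i|) m @[m --> \oo]
       --> `|L - e i * t ^+ i|.
      by apply: cvg_norm; apply: cvgB => //; exact: cvg_cst.
    rewrite -(cvg_lim _ cL') //; apply: limr_le; first by apply/cvg_ex; eexists; exact: cL'.
    near=> m; apply: le_trans (tail m _) _; first by near: m; exact: nbhs_infty_gt.
    by rewrite ler_wpM2l // lerBlDr lerDl mulr_ge0 // exprn_ge0.
  have ti : 0 < t ^+ i by rewrite exprn_gt0.
  rewrite -(ler_pM2r ti) -[X in _ * X <= _](ger0_norm (ltW ti)) -normrM.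
  have -> : e i * t ^+ i = L - (L - e i * t ^+ i) by ring.
  apply: le_trans (ler_normB _ _) _.
  apply: le_trans (lerD LC Li) _.
  rewrite -mulrA -exprS /K [leRHS]mulrDl; apply: lerD.
    apply: le_trans (_ : `|C| * t ^+ N <= _).
      by rewrite ler_wpM2r ?exprn_ge0 // ler_norm.
    rewrite ler_wpM2l // ler_wiXn2l //; lra.
  by rewrite -mulrA ler_wpM2l // exprMn !exprS !mulrA.
apply/eqP; rewrite -normr_eq0; apply/negP => /negP en0.
have eip : 0 < `|e i| by rewrite lt_neqAle eq_sym en0 normr_ge0.
(* Small enough that [K * t < |e i|]. *)
pose t := Num.min 4^-1 (`|e i| / (2 * (K + 1))).
have K1 : 0 < 2 * (K + 1) by lra.
have t0 : 0 < t by rewrite lt_min; apply/andP; split; [lra|rewrite divr_gt0].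
have := key t; rewrite t0 ge_min lexx => /(_ isT).
have : t * (2 * (K + 1)) <= `|e i| by rewrite -ler_pdivlMr // ge_min lexx orbT.
nra.
Unshelve. all: by end_near. Qed.

Lemma power_series_coef_unique (R : realType) (a : nat -> int) (p : {poly int})
    (N : nat) (C : R) :
  (forall t : R, 0 < t <= 2^-1 -> exists2 L : R,
     series (fun n => (a n)%:~R * t ^+ n) @ \oo --> L &
     `|L - (map_poly intr p).[t]| <= C * t ^+ N) ->
  forall i, (i < N)%N -> a i = p`_i.
Proof.
move=> H i ltiN; apply/eqP; rewrite -subr_eq0 -(intr_eq0 R); apply/eqP.
apply: (@power_series_coef_eq0 R (fun n => (a n - p`_n)%:~R) N C) => // t t12.
have [L cL LC] := H t t12; exists (L - (map_poly intr p).[t]) => //.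
have -> : series (fun n => (a n - p`_n)%:~R * t ^+ n) =
   (fun n => series (fun n => (a n)%:~R * t ^+ n) n -
             series (fun n => (p`_n)%:~R * t ^+ n) n).
  by apply/funext => n; rewrite !seriesEnat /= -sumrB; apply: eq_bigr => j _; rewrite intrB mulrBl.
apply: cvgB => //; apply: cvg_near_cst; near=> n.
rewrite seriesEnat /= big_mkord (@horner_coef_wide _ n).
  by apply: eq_bigr => j _; rewrite coef_map.
apply: leq_trans (size_poly _ _) _.
by near: n; exact: nbhs_infty_ge.
Unshelve. all: by end_near. Qed.

(** * Infinite products against partial products *)

(** [x] stands for an infinite product and [y] for a partial one; staying in [[0, 1]] makes errors
    add under multiplication. *)
Definition approx (R : realType) (c x y : R) := [/\ 0 <= x, x <= y, y <= 1 & y - x <= c].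

Lemma approx_mul (R : realType) (c c' x y x' y' : R) :
  approx c x y -> approx c' x' y' -> approx (c + c') (x * x') (y * y').
Proof.
move=> [x0 xy y1 xyc] [x'0 xy' y'1 xyc']; split.
- by rewrite mulr_ge0.
- by rewrite ler_pM.
- by rewrite mulr_ile1 //; lra.
have -> : y * y' - x * x' = x' * (y - x) + y * (y' - x') by ring.
have y0 := le_trans x0 xy.
apply: lerD.
  by apply: le_trans xyc; apply: ler_piMl; lra.
by apply: le_trans xyc'; apply: ler_piMl; lra.
Qed.

(** The partial products decrease in [[0, 1]], and the factor of index [n] lowers them by at most
    [t ^+ n]; as [t <= 1/2], the geometric tail from [N] is at most [2 * t ^+ N]. *)
Lemma qpoch_approx (R : realType) (t : R) (b s N : nat) : 0 < t <= 2^-1 -> (0 < b)%N ->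
  exists2 L : R, qpoch (t%:C ^+ s) (t%:C ^+ b) = L%:C &
    approx (2 * t ^+ N) L (\prod_(k < N) (1 - t ^+ (s + b * k))).
Proof.
move=> /andP[t0 t2] b0; have t0' := ltW t0; have t1 : t <= 1 by lra.
pose u n := \prod_(0 <= k < n) (1 - t ^+ (s + b * k)).
have uS n : u n.+1 = u n * (1 - t ^+ (s + b * n)) by rewrite /u big_nat_recr.
have fac n : 0 <= t ^+ (s + b * n) <= 1.
  by rewrite exprn_ge0 // exprn_ile1.
have u0 n : 0 <= u n.
  by apply: prodr_ge0 => k _; have := fac k; lra.
have uSle n : u n.+1 <= u n.
  by rewrite uS ler_piMr //; have := fac n; lra.
have udec : {homo u : n m / (n <= m)%N >-> m <= n}.
  by apply/nonincreasing_seqP.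
have u1 n : u n <= 1.
  by apply: le_trans (udec _ _ (leq0n n)) _; rewrite /u big_geq.
have ulow n : u N - 2 * t ^+ N + 2 * t ^+ (N + n) <= u (N + n)%N.
  elim: n => [|n IHn]; first by rewrite addn0 subrK.
  rewrite addnS uS mulrBr mulr1; set m := (N + n)%N in IHn *.
  have : u m * t ^+ (s + b * m) <= t ^+ m.
    apply: le_trans (_ : t ^+ (s + b * m) <= _).
      by rewrite ler_piMl //; have := fac m; lra.
    by rewrite ler_wiXn2l //; nia.
  rewrite exprS; have : 0 <= t ^+ m by rewrite exprn_ge0.
  move: (t ^+ N) (t ^+ m) (_ * _) IHn => x y z; nra.
have cu : cvgn u by apply: nonincreasing_is_cvgn => //; exists 0 => _ [n _ <-].
exists (limn u).
  apply: (@cvg_lim R[i]^o); first exact: norm_hausdorff.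
  have -> : (fun n => \prod_(0 <= k < n) (1 - t%:C ^+ s * (t%:C ^+ b) ^+ k) : R[i]^o)
     = (fun n => (u n)%:C : R[i]^o).
    apply/funext => n; rewrite /u rmorph_prod; apply: eq_bigr => k _.
    by rewrite rmorphB rmorph1 rmorphXn -exprM -exprD.
  exact/cvg_real_complex.
rewrite -(big_mkord xpredT (fun k => 1 - t ^+ (s + b * k))) -/(u N); split => //.
- by apply: limr_ge => //; near=> n.
- exact: nonincreasing_cvgn_ge.
rewrite lerBlDr -lerBlDl; apply: limr_ge => //.
near=> n; have := ulow (n - N)%N; rewrite subnKC; last by near: n; exact: nbhs_infty_ge.
have : 0 <= t ^+ n by rewrite exprn_ge0.
lra.
Unshelve. all: by end_near. Qed.

Lemma qpochs_approx (R : realType) (t : R) (b s N : nat) :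
  0 < t <= 2^-1 -> (0 < s < b)%N ->
  exists2 L : R, qpochs [:: t%:C ^+ s; t%:C ^+ (b - s)] (t%:C ^+ b) = L%:C &
    approx (4 * t ^+ N) L (map_poly intr (theta_prod b s N)).[t].
Proof.
move=> t12 sb; have b0 : (0 < b)%N by lia.
have [L1 E1 A1] := qpoch_approx s N t12 b0.
have [L2 E2 A2] := qpoch_approx (b - s) N t12 b0.
exists (L1 * L2).
  by rewrite /qpochs !big_cons big_nil mulr1 E1 E2 rmorphM.
have -> : 4 * t ^+ N = 2 * t ^+ N + 2 * t ^+ N by ring.
have hp c : (map_poly intr (\prod_(k < N) (1 - 'X^(c + b * k) : {poly int}))).[t] =
   \prod_(k < N) (1 - t ^+ (c + b * k)).
  rewrite rmorph_prod horner_prod; apply: eq_bigr => k _.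
  by rewrite rmorphB rmorph1 /= map_polyXn !hornerE.
by rewrite /theta_prod rmorphM hornerM !hp; apply: approx_mul.
Qed.

(** * Vanishing of both coefficient sequences *)

Lemma qpochs_swap (R : realType) (a b q : R[i]) :
  qpochs [:: a; b] q = qpochs [:: b; a] q.
Proof. by rewrite /qpochs !big_cons big_nil !mulr1 mulrC. Qed.

(** Both products have this shape up to the order of the parameters: [s = 4] for [k] and [s = 2] for
    [l]. *)
Lemma vanishing_coef (R : realType) (s : nat) (a : nat -> int) :
  s = 2%N \/ s = 4%N ->
  (forall q : R[i], `|q| < 1 ->
    series (fun n => (a n)%:~R * q ^+ n : R[i]^o) @ \oo -->
      (qpochs [:: q ^+ s; q ^+ (5 - s)] (q ^+ 5) *
       qpochs [:: q ^+ (s + 5); q ^+ (5 - s)] (q ^+ 10) ^+ 3 : R[i]^o)) ->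
  forall n, a (5 * n + 4)%N = 0.
Proof.
move=> s24 ha n; pose N := (5 * n + 5)%N.
rewrite -(@theta_prod_coef_eq0 s N n) //; last by rewrite /N; lia.
(* [16 = 4 + 3 * 4]: an error [4 * t ^+ N] for each of the four theta products. *)
apply: (@power_series_coef_unique R _ _ N 16); last by rewrite /N; lia.
move=> t t12; have /andP[t0 t2] := t12.
have [|L1 E1 A1] := @qpochs_approx R t 5 s N t12; first lia.
have [|L2 E2 A2] := @qpochs_approx R t 10 (s + 5) N t12; first lia.
have := ha t%:C; rewrite norm_real_complex ltcR ger0_norm ?ltW // => /(_ ltac:(lra)).
rewrite E1; move: E2; have -> : (10 - (s + 5) = 5 - s)%N by lia.
move=> -> cF; exists (L1 * L2 ^+ 3).
  have Es : (fun m => (series (fun j => (a j)%:~R * t ^+ j) m)%:C : R[i]^o) =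
      series (fun j => (a j)%:~R * t%:C ^+ j : R[i]^o).
    apply/funext => m; rewrite !seriesEnat /= rmorph_sum; apply: eq_bigr => j _.
    by rewrite rmorphM rmorphXn rmorph_int.
  by apply/cvg_real_complex; rewrite Es rmorphM rmorphXn.
have [_ le _ d] := approx_mul A1 (approx_mul A2 (approx_mul A2 A2)).
rewrite rmorphM rmorphXn /= hornerM horner_exp distrC !exprS !expr0 !mulr1.
by rewrite ger0_norm ?subr_ge0 //; apply: le_trans d _; lra.
Qed.

Theorem theorem12 (R : realType) (k l : nat -> int)
  (hk : forall q : R[i], `|q| < 1 ->
    series (fun n => (k n)%:~R * q ^+ n : R[i]^o) @ \oo -->
      (qpochs [:: q; q ^+ 4] (q ^+ 5) *
       qpochs [:: q; q ^+ 9] (q ^+ 10) ^+ 3 : R[i]^o))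
  (hl : forall q : R[i], `|q| < 1 ->
    series (fun n => (l n)%:~R * q ^+ n : R[i]^o) @ \oo -->
      (qpochs [:: q ^+ 2; q ^+ 3] (q ^+ 5) *
       qpochs [:: q ^+ 3; q ^+ 7] (q ^+ 10) ^+ 3 : R[i]^o)) :
  forall n : nat, k (5 * n + 4)%N = 0 /\ l (5 * n + 4)%N = 0.
Proof.
move=> n; split.
- apply: (@vanishing_coef R 4); first by right.
  move=> q q1; rewrite subSnn expr1 qpochs_swap (qpochs_swap _ q); exact: hk.
- apply: (@vanishing_coef R 2); first by left.
  by move=> q q1; rewrite (qpochs_swap (q ^+ (2 + 5))); exact: hl.
Qed.
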